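(* Let $B$ be a finite set with $k\ge2$ elements equipped with operators $t_1,\dots,t_p$, let $n,m\ge1$, and let $H_1\subset H_2\subset\cdots\subset H_s=B$ be a nested sequence of bearing subspaces of $B$. (i) Consider a $k$-valued network $X_i(t+1)=f_i(X_1(t),\dots,X_n(t))$, $i\in[1,n]$, with bearing space $B$ and algebraic form $x(t+1)=Mx(t)$. Then there exists a coordinate transformation $Z=T(X)$ such that, in the coordinate frame $Z$, the algebraic form becomes $z(t+1)=\tilde M z(t)$, where $\tilde M$ has the cascading (upper block triangular) form $$\tilde M=\begin{bmatrix}D_{1,1}&D_{1,2}&\cdots&D_{1,s}\\0&D_{2,2}&\cdots&D_{2,s}\\ \vdots&&\ddots&\\0&0&\cdots&D_{s,s}\end{bmatrix},$$ and the nested leading diagonal square blocks $D_{1,1}$, $\begin{bmatrix}D_{1,1}&D_{1,2}\\0&D_{2,2}\end{bmatrix}$, $\dots$, $\tilde M$ correspond to $H_1\subset H_2\subset\cdots\subset H_s$ respectively. (ii) Consider a $k$-valued control network $X_i(t+1)=f_i(X_1(t),\dots,X_n(t),U_1(t),\dots,U_m(t))$, $i\in[1,n]$, with bearing space $B$, let $r\in[1,s]$, and assume the controls take values in $H_r$ ($U_j\in H_r$, $j\in[1,m]$). Then there exists a coordinate transformation $Z=T(X)$ such that, in the coordinate frame $Z$, the algebraic form becomes $z(t+1)=\tilde L(u)z(t)$ with $$\tilde L(u)=\begin{bmatrix}L_{1,1}&L_{1,2}\\0&L_{2,2}\end{bmatrix},$$ where $L_{1,1}$ corresponds to $H_r$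.
   Context: Notation. $[1,n]=\{1,\dots,n\}$; $\delta_N^i$ is the $i$-th column of $I_N$; $\Delta_N=\{\delta_N^1,\dots,\delta_N^N\}$. The elements of $B$ are identified with $\delta_k^1,\dots,\delta_k^k$, and a state $(X_1,\dots,X_n)\in B^n$ with $x=x_1\otimes\cdots\otimes x_n\in\Delta_{k^n}$; similarly $u=u_1\otimes\cdots\otimes u_m$ for controls. The algebraic form of a network is $x(t+1)=Mx(t)$, where $M$ is the unique $k^n\times k^n$ matrix with columns in $\Delta_{k^n}$ representing the one-step map; for a control network it is $x(t+1)=L(u)x(t)$, where for each fixed control value $u$, $L(u)$ is the analogous $k^n\times k^n$ matrix. Bearing space: a network has bearing space $B$ with operators $t_1,\dots,t_p$ (finitary operations on $B$) if its state and control variables take values in $B$ and its update functions $f_i$ are compositions of these operators and the variables. Bearing subspace: a (nonempty) subset $H\subset B$ closed under every operator $t_i$. For such $H$, $\mathcal{X}|_H=\{(X_1,\dots,X_n)\in B^n\mid X_i\in H \text{ for all } i\}$. Coordinate transformation: a bijection of the state space, i.e. $x=Tz$ with $T$ a $k^n\times k^n$ permutation matrix; in the frame $z$ the matrix $M$ becomes $T^{\mathrm T}MT$ (and $L(u)$ becomes $T^{\mathrm T}L(u)T$). In (ii), one and the same $T$ serves all control values in $H_r$. A leading diagonal square block ''corresponds to $H_i$'' if it has size $|H_i|^n$ and the first $|H_i|^n$ canonical vectors $\delta_{k^n}^1,\dots,\delta_{k^n}^{|H_i|^n}$ in the frame $z$ represent exactly the states in $\mathcal{X}|_{H_i}$ (so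 the block is the matrix of the dynamics restricted to $\mathcal{X}|_{H_i}$). *)

(* Defs.v *)
From mathcomp Require Import all_boot all_order all_algebra.
From mathcomp Require Import mxtens.

Set Implicit Arguments.
Unset Strict Implicit.
Unset Printing Implicit Defensive.

Import GRing.Theory.
Local Open Scope ring_scope.

Section Operators.

Variables (B : finType) (p : nat) (ar : 'I_p -> nat).

(* Formal compositions of the operator symbols 0, ..., p - 1 (symbol j having
   arity ar j) and of variables indexed by V. *)
Inductive term (V : Type) : Type :=
  | Var of V
  | App (j : 'I_p) of ('I_(ar j) -> term V).

Variable op : forall j : 'I_p, {ffun 'I_(ar j) -> B} -> B.

Fixpoint eval (V : Type) (X : V -> B) (w : term V) : B :=
  match w with
  | Var v => X v
  | App j args => op [ffun i => eval X (args i)]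
  end.

Definition is_composition (V : Type) (g : (V -> B) -> B) : Prop :=
  exists w : term V, forall X, g X = eval X w.

Definition bearing_subspace (H : {set B}) : Prop :=
  H != set0 /\
  forall (j : 'I_p) (a : {ffun 'I_(ar j) -> B}),
    (forall i, a i \in H) -> op a \in H.

End Operators.

Section Networks.

Variable B : finType.

Definition state (n : nat) := {ffun 'I_n -> B}.

Definition network (n : nat) := 'I_n -> state n -> B.

Definition control_network (n m : nat) := 'I_n -> state n -> state m -> B.

Definition step n (f : network n) (X : state n) : state n := [ffun i => f i X].

Definition control_step n m (f : control_network n m) (U : state m)
    (X : state n) : state n := [ffun i => f i X U].

Definition has_bearing_space p (ar : 'I_p -> nat)
    (op : forall j : 'I_p, {ffun 'I_(ar j) -> B} -> B) n (f : network n) : Prop :=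
  forall i, is_composition op (fun X : 'I_n -> B => f i (finfun X)).

(* The variables of a control network are the n states (inl) and the m controls
   (inr). *)
Definition control_has_bearing_space p (ar : 'I_p -> nat)
    (op : forall j : 'I_p, {ffun 'I_(ar j) -> B} -> B)
    n m (f : control_network n m) : Prop :=
  forall i, is_composition op
    (fun X : 'I_n + 'I_m -> B => f i [ffun l => X (inl l)] [ffun j => X (inr j)]).

Definition restricted_states n (H : {set B}) : {set state n} :=
  [set X : state n | [forall i, X i \in H]].

End Networks.

Section AlgebraicForm.

Variable R : nzRingType.

(* [delta N a] is the (a + 1)-st column of the N x N identity matrix. *)
Definition delta (N : nat) (a : 'I_N) : 'cV[R]_N := delta_mx a 0.

Definition logical_matrix (N N' : nat) (M : 'M[R]_(N, N')) : Prop :=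
  forall b, exists a, col b M = delta a.

(* Iterated Kronecker product x_0 *t x_1 *t ... *t x_(n-1). *)
Fixpoint kron (k n : nat) : ('I_n -> 'cV[R]_k) -> 'cV[R]_(k ^ n) :=
  match n with
  | 0 => fun _ => 1%:M
  | n'.+1 => fun x => castmx (esym (expnS k n'), muln1 1)
                        (x ord0 *t kron (fun i => x (lift ord0 i)))
  end.

Variables (B : finType) (k : nat) (code : B -> 'I_k).

(* Vector form of a state, b : B being identified with the basis vector of
   index code b. *)
Definition vec n (X : state B n) : 'cV[R]_(k ^ n) :=
  kron (fun i => delta (code (X i))).

(* M is the algebraic form of the one-step map F. *)
Definition algebraic_form n (F : state B n -> state B n) (M : 'M[R]_(k ^ n)) :
    Prop :=
  logical_matrix M /\ forall X, M *m vec X = vec (F X).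

(* The matrix M read in the frame z, where x = T z. *)
Definition in_frame N (T M : 'M[R]_N) : 'M[R]_N := T^T *m M *m T.

(* A leading diagonal square block of size N corresponds to H in the frame z,
   where x = T z: N = #|H| ^ n, and the first N canonical vectors of the frame
   represent exactly the states all of whose entries lie in H. *)
Definition corresponds n (T : 'M[R]_(k ^ n)) (N : nat) (H : {set B}) : Prop :=
  N = (#|H| ^ n)%N /\
  forall x : 'cV[R]_(k ^ n),
    (exists2 a : 'I_(k ^ n), (a < N)%N & x = T *m delta a) <->
    (exists2 X : state B n, X \in restricted_states n H & x = vec X).

End AlgebraicForm.

Section AlgebraicFormUnique.

Variable R : nzRingType.

Fixpoint kron_index (k n : nat) : ('I_n -> 'I_k) -> 'I_(k ^ n) :=
  match n with
  | 0 => fun _ => ord0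
  | n'.+1 => fun c => cast_ord (esym (expnS k n'))
      (mxtens_index (c ord0, kron_index (fun i => c (lift ord0 i))))
  end.

Lemma kron_delta k n (c : 'I_n -> 'I_k) :
  kron (fun i => delta R (c i)) = delta R (kron_index c).
Proof.
elim: n c => [|n IH] c.
  by apply/matrixP => i j; rewrite !mxE !ord1.
rewrite /= IH; apply/matrixP => i j; rewrite castmxE !mxE /= !ord1 !andbT.
rewrite -natrM mulnb; congr (_ : bool)%:R; rewrite esymK.
set i' := cast_ord (expnS k n) i.
rewrite -[i in RHS](cast_ordK (expnS k n)) (inj_eq (@cast_ord_inj _ _ _)) -/i'.
by rewrite -(can_eq (@mxtens_unindexK _ _)) mxtens_indexK xpair_eqE.
Qed.

Lemma kron_index_inj k n (c c' : 'I_n -> 'I_k) :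
  kron_index c = kron_index c' -> c =1 c'.
Proof.
elim: n c c' => [|n IH] c c' /=; first by move=> _ [].
move=> /cast_ord_inj /(can_inj (@mxtens_indexK _ _)) [e0 /IH e1] i.
by case: (unliftP ord0 i) => [j|] ->; [exact: e1 | exact: e0].
Qed.

(* "The" algebraic form exists and is unique. *)
Lemma algebraic_form_exists_unique (B : finType) k (code : B -> 'I_k) n
    (F : state B n -> state B n) :
  bijective code -> exists! M : 'M[R]_(k ^ n), algebraic_form code F M.
Proof.
move=> bij_code.
pose idx (X : state B n) := kron_index (fun i => code (X i)).
have vecE X : vec R code X = delta R (idx X) by exact: kron_delta.
have idx_inj : injective idx.
  move=> X Y /kron_index_inj eXY; apply/ffunP => i.
  exact: (bij_inj bij_code) (eXY i).
have [|idx' idxK idx'K] := inj_card_bij idx_inj.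
  by rewrite card_ffun !card_ord (bij_eq_card bij_code) card_ord.
exists (\matrix_(a, b) (a == idx (F (idx' b)))%:R); split.
  have col_M b : col b (\matrix_(a, b) (a == idx (F (idx' b)))%:R)
                = delta R (idx (F (idx' b))).
    by apply/matrixP => a c; rewrite !mxE ord1 andbT.
  split=> [b|X]; first by exists (idx (F (idx' b))); exact: col_M.
  by rewrite !vecE {1}/delta -colE col_M idxK.
move=> M [_ MF]; apply/matrixP => a b.
have := congr1 (fun v : 'cV[R]_(k ^ n) => v a 0) (MF (idx' b)).
by rewrite !vecE {1}/delta idx'K -colE !mxE andbT.
Qed.

End AlgebraicFormUnique.

(* Main.v *)
(** A bearing subspace is closed under every composition of the operators, so
the states with all entries in H_i form a forward invariant set.  Listing the
states of the smallest H_1 first, then the remaining ones of H_2, and so on,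
is a permutation of the canonical basis after which every one of these
invariant sets is spanned by a leading segment of the basis, and invariance
says precisely that the entries below the diagonal blocks vanish.  The frame
depends on the chain of subspaces only, so it serves all controls at once. *)

Require Import Defs.
From mathcomp Require Import all_boot all_order all_algebra.
From mathcomp Require Import fingroup perm.

Set Implicit Arguments.
Unset Strict Implicit.
Unset Printing Implicit Defensive.

Import GRing.Theory.
Local Open Scope ring_scope.

(** Once an entry fails [P], so does everything sorted after it. Hence the entries satisfying [P]
    form an initial segment, whose length is their count. *)
Lemma sorted_nth_count (T : Type) (r : rel T) (P : pred T) (x0 : T)
    (s : seq T) (i : nat) :
  transitive r -> (forall x y, r x y -> P y -> P x) ->
  sorted r s -> (i < size s)%N -> P (nth x0 s i) = (i < count P s)%N.
Proof.
move=> r_tr Pr; elim: s i => // x s IH i s_sorted lt_i.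
have r_s := order_path_min r_tr s_sorted.
have {}IH j := IH j (path_sorted s_sorted).
case Px: (P x) => /=.
  by case: i lt_i => [|i] lt_i; rewrite Px add1n //= IH.
have nPs : ~~ has P s.
  elim: s r_s {IH s_sorted lt_i} => //= y s IHs /andP[rxy rxs].
  rewrite negb_or IHs // andbT; apply: contraFN Px; exact: Pr.
have cs : count P s = 0%N by apply/eqP; rewrite -leqn0 leqNgt -has_count.
by case: i lt_i => [|i] lt_i; rewrite Px cs //= IH // cs.
Qed.

(** Sort the indices by the preorder [r], for which every [S i] is downward closed; [t] reads off
    the sorted list. *)
Lemma chain_perm (I : finType) (N : nat) (S : I -> {set 'I_N}) :
  (forall i j, (S i \subset S j) || (S j \subset S i)) ->
  exists t : 'S_N, forall i a, (t a \in S i) = (a < #|S i|)%N.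
Proof.
case: N S => [|N] S S_chain; first by exists 1%g => i [].
pose r x y := [forall i, (y \in S i) ==> (x \in S i)].
have r_tr : transitive r.
  move=> y x z /forallP rxy /forallP ryz; apply/forallP => i.
  by apply/implyP => /(implyP (ryz i)) /(implyP (rxy i)).
have r_total : total r.
  (* If [S i] contains [y] but not [x], a set [S j] containing [x] cannot lie inside [S i], so it
     contains [S i] and hence [y]. *)
  move=> x y; rewrite /r; case: forallP => //= /forallP/forallPn[i].
  rewrite negb_imply => /andP[yi xi]; apply/forallP => j; apply/implyP => xj.
  case/orP: (S_chain i j) => /subsetP sij; first exact: sij.
  by rewrite sij in xi.
pose l := sort r (enum 'I_N.+1).
have size_l : size l = N.+1 by rewrite size_sort size_enum_ord.
have l_uniq : uniq l by rewrite sort_uniq enum_uniq.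
have nth_inj : injective (fun a : 'I_N.+1 => nth ord0 l a).
  by move=> a b /eqP; rewrite nth_uniq ?size_l // => /eqP/val_inj.
exists (perm nth_inj) => i a; rewrite permE.
have := @sorted_nth_count _ r [in S i] ord0 l a r_tr.
rewrite size_l sort_sorted // count_sort -size_filter cardE enumT => -> //.
by move=> x y /forallP rxy /(implyP (rxy i)).
Qed.

Section Invariance.

Variables (B : finType) (p : nat) (ar : 'I_p -> nat).
Variable op : forall j : 'I_p, {ffun 'I_(ar j) -> B} -> B.

Lemma eval_bearing (V : Type) (X : V -> B) (w : term ar V) (H : {set B}) :
  bearing_subspace op H -> (forall v, X v \in H) -> eval op X w \in H.
Proof.
move=> [_ Hop] HX; elim: w => [v|j args IH] /=; first exact: HX.
by apply: Hop => i; rewrite ffunE.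
Qed.

Lemma step_bearing n (f : network B n) (H : {set B}) :
  has_bearing_space op f -> bearing_subspace op H ->
  {homo step f : X / X \in restricted_states n H}.
Proof.
move=> f_op HH X; rewrite !inE => /forallP XH; apply/forallP => i.
(* The composition [w] is evaluated on plain functions, so [X] is first put in the form
   [finfun X]. *)
have [w fE] := f_op i; rewrite ffunE -[X](fgraphK X).
have -> : Finfun (fgraph X) = finfun X by apply/ffunP => j; rewrite fgraphK ffunE.
by rewrite fE eval_bearing.
Qed.

Lemma control_step_bearing n m (f : control_network B n m) (H : {set B}) U :
  control_has_bearing_space op f -> bearing_subspace op H ->
  U \in restricted_states m H ->
  {homo control_step f U : X / X \in restricted_states n H}.
Proof.
move=> f_op HH; rewrite inE => /forallP UH X.
rewrite !inE => /forallP XH; apply/forallP => i.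
have [w fE] := f_op i; rewrite ffunE.
have := fE (fun v => match v with inl l => X l | inr j => U j end).
have -> : [ffun l => X l] = X by apply/ffunP => l; rewrite ffunE.
have -> : [ffun j => U j] = U by apply/ffunP => l; rewrite ffunE.
by move=> ->; apply: eval_bearing => // -[].
Qed.

End Invariance.

Lemma card_restricted_states (B : finType) n (H : {set B}) :
  #|restricted_states n H| = (#|H| ^ n)%N.
Proof.
rewrite -[n in RHS]card_ord -card_ffun_on; apply: eq_card => X.
by rewrite inE.
Qed.

Section Frames.

Variables (R : nzRingType) (B : finType) (k : nat) (code : B -> 'I_k).

Lemma exists_frame n (I : finType) (H : I -> {set B}) :
  injective code ->
  (forall i j, (H i \subset H j) || (H j \subset H i)) ->
  exists T : 'M[R]_(k ^ n), is_perm_mx T /\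
    forall i, corresponds code T (#|H i| ^ n)%N (H i).
Proof.
move=> code_inj H_chain.
pose idx (X : state B n) := kron_index (fun i => code (X i)).
have vecE X : vec R code X = delta R (idx X) by exact: kron_delta.
have idx_inj : injective idx.
  by move=> X Y /kron_index_inj eXY; apply/ffunP => i; apply: code_inj.
pose S i := idx @: restricted_states n (H i).
have sub_S i j : H i \subset H j -> S i \subset S j.
  move=> /subsetP sij; apply: imsetS; apply/subsetP => X; rewrite !inE.
  by move=> /forallP XH; apply/forallP => l; apply: sij.
have [|t tS] := @chain_perm I (k ^ n) S.
  by move=> i j; case/orP: (H_chain i j) => /sub_S ->; rewrite ?orbT.
have card_S i : #|S i| = (#|H i| ^ n)%N.
  by rewrite card_imset // card_restricted_states.
(* The inverse appears because [perm_mx] permutes rows: on canonical columns it acts by the inverse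
   permutation. *)
have T_delta a : perm_mx t^-1 *m delta R a = delta R (t a).
  rewrite /delta -colE; apply/matrixP => b c.
  by rewrite !mxE ord1 andbT -(inj_eq (@perm_inj _ t)) permKV.
exists (perm_mx t^-1); split; first by apply/existsP; exists t^-1%g.
move=> i; split=> // x; split=> [[a lt_a ->]|[X XH ->]].
  have: t a \in S i by rewrite tS card_S.
  by case/imsetP => X XH ta; exists X; rewrite // vecE T_delta ta.
exists ((t^-1)%g (idx X)); last by rewrite vecE T_delta permKV.
by rewrite -card_S -tS permKV imset_f.
Qed.

(** For [b < N], column [b] encodes the successor of a state over [H]. That successor is again over
    [H], so the column is some [delta R a'] with [a' < N] and vanishes from row [N] on. *)
Lemma in_frame_invariant n (T M : 'M[R]_(k ^ n)) N (H : {set B}) F :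
  is_perm_mx T -> corresponds code T N H -> algebraic_form code F M ->
  {homo F : X / X \in restricted_states n H} ->
  forall a b : 'I_(k ^ n), (b < N)%N -> (N <= a)%N -> in_frame T M a b = 0.
Proof.
move=> /existsP[t /eqP Tt] [_ TH] [_ MF] FH a b lt_b le_a.
have TT : T^T *m T = 1%:M by rewrite Tt tr_perm_mx -perm_mxM mulVg perm_mx1.
have [|X XH TX] := (TH (T *m delta R b)).1; first by exists b.
have [|a' lt_a' FX] := (TH (vec R code (F X))).2.
  by exists (F X) => //; apply: FH.
have col_b : col b (in_frame T M) = delta R a'.
  by rewrite colE /in_frame -!mulmxA TX MF FX mulmxA TT mul1mx.
have -> : in_frame T M a b = col b (in_frame T M) a 0 by rewrite [RHS]mxE.
by rewrite col_b mxE; case: eqP le_a => // ->; rewrite leqNgt lt_a'.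
Qed.

End Frames.

Theorem proposition25
    (R : nzRingType)
    (B : finType) (k : nat) (hk : (2 <= k)%N)
    (code : B -> 'I_k) (code_bij : bijective code)
    (p : nat) (ar : 'I_p -> nat)
    (op : forall j : 'I_p, {ffun 'I_(ar j) -> B} -> B)
    (n m : nat) (hn : (1 <= n)%N) (hm : (1 <= m)%N)
    (s : nat) (H : 'I_s.+1 -> {set B})
    (H_bearing : forall i, bearing_subspace op (H i))
    (H_nested : forall i j : 'I_s.+1, (i <= j)%N -> H i \subset H j)
    (H_last : H ord_max = [set: B]) :
  (forall (f : network B n) (M : 'M[R]_(k ^ n)),
      has_bearing_space op f ->
      algebraic_form code (step f) M ->
      exists T : 'M[R]_(k ^ n), is_perm_mx T /\
      exists (d : 'I_s.+1 -> nat) (dE : (\sum_(i < s.+1) d i)%N = (k ^ n)%N)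
             (D : forall i j : 'I_s.+1, 'M[R]_(d i, d j)),
        [/\ in_frame T M = castmx (dE, dE) (\mxblock_(i < s.+1, j < s.+1) D i j),
            forall i j : 'I_s.+1, (j < i)%N -> D i j = 0
          & forall i : 'I_s.+1,
              corresponds code T (\sum_(j < s.+1 | (j <= i)%N) d j)%N (H i)])
  /\
  (forall (f : control_network B n m) (L : 'cV[R]_(k ^ m) -> 'M[R]_(k ^ n))
          (r : 'I_s.+1),
      control_has_bearing_space op f ->
      (forall U : state B m, algebraic_form code (control_step f U) (L (vec R code U))) ->
      exists T : 'M[R]_(k ^ n), is_perm_mx T /\
      exists (d1 d2 : nat) (dE : (d1 + d2)%N = (k ^ n)%N),
        corresponds code T d1 (H r) /\
        forall U : state B m, (forall j, U j \in H r) ->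
        exists (L11 : 'M[R]_(d1, d1)) (L12 : 'M[R]_(d1, d2)) (L22 : 'M[R]_(d2, d2)),
          in_frame T (L (vec R code U)) = castmx (dE, dE) (block_mx L11 L12 0 L22)).
Proof.
have kE : k = #|B| by rewrite (bij_eq_card code_bij) card_ord.
have H_chain i j : (H i \subset H j) || (H j \subset H i).
  by case/orP: (leq_total i j) => /H_nested ->; rewrite ?orbT.
have [T [T_perm TH]] := exists_frame R n (bij_inj code_bij) H_chain.
split; last first.
  move=> f L r f_op LE; exists T; split=> //.
  have le_d : (#|H r| ^ n <= k ^ n)%N.
    by rewrite leq_exp2r // kE max_card.
  exists (#|H r| ^ n)%N, (k ^ n - #|H r| ^ n)%N, (subnKC le_d); split=> // U UH.
  set A := in_frame _ _.
  pose A' := castmx (esym (subnKC le_d), esym (subnKC le_d)) A.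
  exists (ulsubmx A'), (ursubmx A'), (drsubmx A').
  (* Rows of this block are shifted by [#|H r| ^ n] and its columns lie below that bound, so
     invariance under each fixed control applies. *)
  have <- : dlsubmx A' = 0.
    apply/matrixP => a b; rewrite !mxE castmxE.
    rewrite (in_frame_invariant T_perm (TH r) (LE U)) ?mxE //=; last exact: leq_addr.
    by apply: (control_step_bearing f_op) => //; rewrite inE; apply/forallP.
  by rewrite submxK castmxKV.
move=> f M f_op ME; exists T; split=> //.
(* [e] lists the block boundaries, shifted by one so that [e 0 = 0]. Thus [d i] counts the states
   over [H i] that are not over the preceding subspace. *)
pose e (i : nat) := if i is i'.+1 then (#|H (inord i')| ^ n)%N else 0%N.
pose d (i : 'I_s.+1) := (e i.+1 - e i)%N.
have e_last : e s.+1 = (k ^ n)%N.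
  rewrite /e kE (_ : inord s = ord_max) ?H_last ?cardsT //.
  by apply: val_inj; apply: inordK.
have e_mono i j : (i <= j <= s.+1)%N -> (e i <= e j)%N.
  case: i j => [|i] [|j] // /andP[le_ij lt_j].
  rewrite leq_exp2r // subset_leq_card // H_nested //.
  by rewrite !inordK // (leq_trans le_ij).
have sum_d i : (i <= s.+1)%N -> (\sum_(j < s.+1 | (j < i)%N) d j)%N = e i.
  move=> le_i; rewrite (big_ord_narrow le_i) /=.
  rewrite -(big_mkord xpredT (fun j => e j.+1 - e j)%N).
  rewrite telescope_sumn_in ?subn0 // => j /andP[_ lt_j].
  by rewrite e_mono // leqnSn (leq_trans lt_j).
have eE (i : 'I_s.+1) : e i.+1 = (#|H i| ^ n)%N by rewrite /e inord_val.
have dE : (\sum_(i < s.+1) d i)%N = (k ^ n)%N.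
  by rewrite -e_last -sum_d //; apply: eq_bigl => i; rewrite ltn_ord.
(* [tagnat.Rank i c] is the position in the whole matrix of index [c] of block [i]. *)
have Rank_bounds i (c : 'I_(d i)) : (e i <= tagnat.Rank i c < e i.+1)%N.
  rewrite tagnat.RankEsum sum_d ?(ltnW (ltn_ord i)) // leq_addr /=.
  by rewrite -ltn_subRL ltn_ord.
pose A' := castmx (esym dE, esym dE) (in_frame T M).
exists d, dE, (fun i j => submxblock A' i j); split=> [|i j lt_ji|i].
- by rewrite submxblockK castmxKV.
- apply/matrixP => a b; rewrite !mxE castmxE.
  have lt_b : (tagnat.Rank j b < #|H j| ^ n)%N.
    by rewrite -eE; case/andP: (Rank_bounds j b).
  apply: (in_frame_invariant T_perm (TH j) ME (step_bearing f_op _)) => //.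
  case/andP: (Rank_bounds i a) => le_a _; apply: leq_trans le_a.
  (* As [j < i], block row [i] starts at [e i], at or beyond the end [e j.+1] of block column
     [j]. *)
  by rewrite -eE e_mono // lt_ji ltnW.
- have -> : (\sum_(j < s.+1 | (j <= i)%N) d j)%N = (#|H i| ^ n)%N.
    (* The condition [j <= i] is [j < i.+1] by conversion, so the telescoped sum applies at
       [i.+1]. *)
    by rewrite -eE -sum_d.
  exact: TH.
Qed.
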